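(* Let $e,e'$ be expressions with $\mathcal{E}[\![e]\!]=\mathcal{E}[\![e']\!]$ (i.e. $\mathcal{E}[\![e]\!]\rho=\mathcal{E}[\![e']\!]\rho$ for every environment $\rho$). Then for every closing context $C$ (i.e. every context $C$ such that both $C[e]$ and $C[e']$ have no free variables), $C[e]\Downarrow$ if and only if $C[e']\Downarrow$.
   Context: **Expressions.** $e ::= n \mid e\oplus e \mid x \mid \lambda x.\,e \mid e\;e \mid \mathbf{if}\,e\,\mathbf{then}\,e\,\mathbf{else}\,e$, with $n\in\mathbb{Z}$, $x$ a variable, and $\oplus\in\{+,\times,-,\ldots\}$ a total binary integer operation. **Domain.** $\mathbb{D}$ is inductively defined by $\mathbb{D}=\mathbb{Z}+\mathcal{P}_f(\mathbb{D}\times\mathbb{D})$ ($\mathcal{P}_f$ = finite subsets); $d$ ranges over $\mathbb{D}$, $t$ over finite subsets of $\mathbb{D}\times\mathbb{D}$ (''tables''). The order $\sqsubseteq$ on $\mathbb{D}$: $n\sqsubseteq n$ for integers; $t\sqsubseteq t'$ iff $t\subseteq t'$; nothing else. **Semantics.** For an environment $\rho$ (partial map from variables to $\mathbb{D}$), $\mathcal{E}[\![e]\!]\rho\subseteq\mathbb{D}$ is defined by recursion on $e$: - $\mathcal{E}[\![n]\!]\rho=\{n\}$; $\mathcal{E}[\![x]\!]\rho=\{d\mid d\sqsubseteq\rho(x)\}$ (empty if $\rho(x)$ is undefined); - $\mathcal{E}[\![e_1\oplus e_2]\!]\rho=\{n_1\oplus n_2\mid n_1\in\mathcal{E}[\![e_1]\!]\rho,\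 n_2\in\mathcal{E}[\![e_2]\!]\rho,\ n_1,n_2\in\mathbb{Z}\}$; - $\mathcal{E}[\![\lambda x.e]\!]\rho=\{t\mid\forall(d,d')\in t.\ d'\in\mathcal{E}[\![e]\!]\rho(x{:=}d)\}$; - $\mathcal{E}[\![e_1\,e_2]\!]\rho=\{d\mid\exists t,d_1,d_1',d_2.\ t\in\mathcal{E}[\![e_1]\!]\rho,\ d_2\in\mathcal{E}[\![e_2]\!]\rho,\ (d_1,d_1')\in t,\ d_1\sqsubseteq d_2,\ d\sqsubseteq d_1'\}$; - $\mathcal{E}[\![\mathbf{if}\,e_1\,\mathbf{then}\,e_2\,\mathbf{else}\,e_3]\!]\rho=\{d\mid\exists n\in\mathbb{Z}.\ n\in\mathcal{E}[\![e_1]\!]\rho,\ (n\ne0\Rightarrow d\in\mathcal{E}[\![e_2]\!]\rho),\ (n=0\Rightarrow d\in\mathcal{E}[\![e_3]\!]\rho)\}$. **Contexts.** $C ::= \square\mid C\oplus e\mid e\oplus C\mid\lambda x.C\mid C\,e\mid e\,C$; $C[e]$ is the result of (possibly capturing) replacement of the hole $\square$ by $e$. **Small-step semantics.** Syntactic values $\overline{v} ::= n\mid\lambda x.e$ with $\lambda x.e$ closed. $e[\overline{v}/x]$ is substitution for free occurrences of $x$. $\longrightarrow$ is the standard call-by-value left-to-right reduction: $(\lambda x.e)\,\overline{v}\longrightarrow e[\overline{v}/x]$; $n_1\oplus n_2\longrightarrow n$ where $n$ is the integer $n_1\oplus n_2$; $\mathbf{if}\,n\,\mathbf{then}\,e_2\,\mathbf{else}\,e_3\longrightarrow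 e_2$ if $n\neq0$ and $\longrightarrow e_3$ if $n=0$; and congruence: if $e_1\longrightarrow e_1'$ then $e_1\,e_2\longrightarrow e_1'\,e_2$, $e_1\oplus e_2\longrightarrow e_1'\oplus e_2$, $\mathbf{if}\,e_1\,\mathbf{then}\,e_2\,\mathbf{else}\,e_3\longrightarrow\mathbf{if}\,e_1'\,\mathbf{then}\,e_2\,\mathbf{else}\,e_3$; if $e_2\longrightarrow e_2'$ then $\overline{v}\,e_2\longrightarrow\overline{v}\,e_2'$ and $\overline{v}\oplus e_2\longrightarrow\overline{v}\oplus e_2'$. $\longrightarrow^*$ is its reflexive transitive closure. For a closed expression $e$, $e\Downarrow$ means $e\longrightarrow^*\overline{v}$ for some syntactic value $\overline{v}$. *)

(* Defs.v *)
From HB Require Import structures.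
From mathcomp Require Import all_boot all_order all_algebra finmap.
From mathcomp Require Import classical_sets.
From Stdlib Require Import Relation_Operators.

Set Implicit Arguments.
Unset Strict Implicit.
Unset Printing Implicit Defensive.

Local Open Scope fset_scope.
Local Open Scope classical_set_scope.

(* The domain D = int + {finite subsets of D * D} cannot be declared directly
   as an inductive type, because {fset _} is not strictly positive.  It is the
   subtype of the trees below in which every list of pairs is, hereditarily,
   the canonical enumeration of a finite set.  The lemmas [DInt_inj],
   [DTab_inj], [DInt_DTab] and [D_ind] characterize it up to isomorphism. *)

Inductive tree : Type :=
| TInt of int
| TTab of seq (tree * tree).

Fixpoint tree_encode (x : tree) : GenTree.tree int :=
  match x with
  | TInt n => GenTree.Leaf n
  | TTab s => GenTree.Node 0
      [seq GenTree.Node 0 [:: tree_encode p.1; tree_encode p.2] | p <- s]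
  end.

Fixpoint tree_decode (g : GenTree.tree int) : tree :=
  match g with
  | GenTree.Leaf n => TInt n
  | GenTree.Node _ l => TTab
      [seq match h with
           | GenTree.Node _ [:: a; b] => (tree_decode a, tree_decode b)
           | _ => (TInt 0, TInt 0)
           end | h <- l]
  end.

Lemma tree_encodeK : cancel tree_encode tree_decode.
Proof.
rewrite /cancel; fix F 1 => -[n|s]; first exact: erefl.
rewrite /=; congr TTab; elim: s => [|[y z] s]; first exact: erefl.
rewrite /= => ->; congr ((_, _) :: _); [exact: (F y) | exact: (F z)].
Qed.

HB.instance Definition _ := Countable.copy tree (can_type tree_encodeK).

Lemma tree_nested_ind (P : tree -> Prop) :
  (forall n, P (TInt n)) ->
  (forall s, (forall p, p \in s -> P p.1 /\ P p.2) -> P (TTab s)) ->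
  forall x, P x.
Proof.
move=> Pint Ptab; fix F 1 => -[n|s]; first exact: Pint.
apply: Ptab; elim: s => [|[y z] s IHs] p; first by clear; rewrite in_nil.
rewrite inE; case: eqP => [-> _|_ ps]; last exact: (IHs p ps).
by split; [exact: (F y) | exact: (F z)].
Qed.

Fixpoint norm (x : tree) : tree :=
  match x with
  | TInt n => TInt n
  | TTab s => TTab [fset p | p in [seq (norm p.1, norm p.2) | p <- s]]
  end.

Lemma norm_fset (A : {fset tree * tree}) :
  (forall p, p \in A -> norm p.1 = p.1 /\ norm p.2 = p.2) ->
  norm (TTab A) = TTab A.
Proof.
move=> nA /=; congr (TTab (enum_fset _)); apply/fsetP => q.
rewrite !inE; apply/mapP/idP => [[p pA ->]|qA].
  by have [-> ->] := nA p pA; rewrite -surjective_pairing.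
by exists q => //; have [-> ->] := nA q qA; rewrite -surjective_pairing.
Qed.

Lemma norm_id x : norm (norm x) = norm x.
Proof.
elim/tree_nested_ind: x => // s IHs; rewrite [norm (TTab s)]/=.
by apply: norm_fset => q; rewrite !inE => /mapP[p /IHs[? ?] ->].
Qed.

Record D : Type := MkD { Dval : tree; _ : norm Dval == Dval }.
HB.instance Definition _ := [isSub for Dval].
HB.instance Definition _ := [Choice of D by <:].

Definition pair_val (p : D * D) : tree * tree := (val p.1, val p.2).

Lemma pair_val_inj : injective pair_val.
Proof. by move=> [a b] [a' b'] [/val_inj -> /val_inj ->]. Qed.

Definition DInt (n : int) : D := @MkD (TInt n) (eqxx _).

Lemma DTab_subproof (t : {fset D * D}) :
  norm (TTab [fset pair_val p | p in t]) == TTab [fset pair_val p | p in t].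
Proof.
apply/eqP; apply: norm_fset => q /imfsetP[[a b] _ ->] /=.
by split; [exact/eqP/(valP a) | exact/eqP/(valP b)].
Qed.

Definition DTab (t : {fset D * D}) : D := MkD (DTab_subproof t).

Lemma DInt_inj : injective DInt.
Proof. by move=> m n []. Qed.

Lemma DTab_inj : injective DTab.
Proof.
move=> t t' [/val_inj /fsetP tt']; apply/fsetP => p.
have := tt' (pair_val p).
by rewrite !mem_imfset //; exact: pair_val_inj.
Qed.

Lemma DInt_DTab n t : DInt n <> DTab t.
Proof. by []. Qed.

Lemma D_ind (P : D -> Prop) :
  (forall n, P (DInt n)) ->
  (forall t : {fset D * D},
    (forall d d' : D, (d, d') \in t -> P d /\ P d') -> P (DTab t)) ->
  forall d, P d.
Proof.
move=> Pint Ptab [x nx].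
elim/tree_nested_ind: x nx => [n|s IHs] nx.
  by rewrite (_ : MkD nx = DInt n) //; apply: val_inj.
pose F := [fset p | p in [seq (norm p.1, norm p.2) | p <- s]].
have sF : enum_fset F = s by have /eqP[] := nx.
have nF p : p \in F -> norm p.1 == p.1 /\ norm p.2 == p.2.
  by rewrite !inE => /mapP[q _ ->]; rewrite !norm_id.
pose f (p : tree * tree) : D * D :=
  (insubd (DInt 0) p.1, insubd (DInt 0) p.2).
have fK p : p \in F -> pair_val (f p) = p.
  case: p => y z /nF[ny nz]; rewrite /pair_val /f /=.
  by rewrite !val_insubd ny nz.
rewrite (_ : MkD nx = DTab [fset f p | p in F]).
  apply: Ptab => d d' /imfsetP[[y z] /= yzF [-> ->]].
  have [ny nz] := nF _ yzF.
  have yzs : (y, z) \in s by rewrite -sF.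
  have [Py Pz] := IHs _ yzs.
  by split; rewrite /insubd insubT; [exact: Py | exact: Pz].
apply: val_inj; transitivity (TTab F); first by rewrite sF.
rewrite /=; congr (TTab (enum_fset _)).
apply/fsetP => p; apply/idP/imfsetP => [pF|[_ /imfsetP[q qF ->] ->]].
  by exists (f p); [exact: in_imfset | rewrite fK].
by rewrite fK.
Qed.

Inductive leD : D -> D -> Prop :=
| leD_int n : leD (DInt n) (DInt n)
| leD_tab (t t' : {fset D * D}) : (t `<=` t')%fset -> leD (DTab t) (DTab t').

Definition var := nat.

Section Language.

(* The names of the primitive operations; [opI] below interprets each of them
   as a total binary operation on integers. *)
Variable Op : Type.

Inductive expr : Type :=
| EInt of int
| EOp of Op & expr & expr
| EVar of var
| ELam of var & expr
| EApp of expr & expr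
| EIf of expr & expr & expr.

Inductive ctx : Type :=
| CHole
| COpL of Op & ctx & expr
| COpR of Op & expr & ctx
| CLam of var & ctx
| CAppL of ctx & expr
| CAppR of expr & ctx.

Fixpoint plug (C : ctx) (e : expr) : expr :=
  match C with
  | CHole => e
  | COpL o C1 e2 => EOp o (plug C1 e) e2
  | COpR o e1 C2 => EOp o e1 (plug C2 e)
  | CLam x C1 => ELam x (plug C1 e)
  | CAppL C1 e2 => EApp (plug C1 e) e2
  | CAppR e1 C2 => EApp e1 (plug C2 e)
  end.

Fixpoint fv (e : expr) : seq var :=
  match e with
  | EInt _ => [::]
  | EOp _ e1 e2 => fv e1 ++ fv e2
  | EVar x => [:: x]
  | ELam x e1 => [seq y <- fv e1 | y != x]
  | EApp e1 e2 => fv e1 ++ fv e2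
  | EIf e1 e2 e3 => fv e1 ++ fv e2 ++ fv e3
  end.

Definition closed_expr (e : expr) : bool := nilp (fv e).

Definition is_value (e : expr) : bool :=
  match e with
  | EInt _ => true
  | ELam _ _ => closed_expr e
  | _ => false
  end.

(* Capture needs no care: only values, which are closed, are substituted. *)
Fixpoint subst (x : var) (v e : expr) : expr :=
  match e with
  | EInt n => EInt n
  | EOp o e1 e2 => EOp o (subst x v e1) (subst x v e2)
  | EVar y => if y == x then v else EVar y
  | ELam y e1 => ELam y (if y == x then e1 else subst x v e1)
  | EApp e1 e2 => EApp (subst x v e1) (subst x v e2)
  | EIf e1 e2 e3 => EIf (subst x v e1) (subst x v e2) (subst x v e3)
  end.

Variable opI : Op -> int -> int -> int.

Definition env := var -> option D.

Definition upd (rho : env) (x : var) (d : D) : env :=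
  fun y => if y == x then Some d else rho y.

Fixpoint sem (e : expr) (rho : env) : set D :=
  match e with
  | EInt n => [set DInt n]
  | EOp o e1 e2 =>
      [set d | exists n1 n2, [/\ sem e1 rho (DInt n1), sem e2 rho (DInt n2)
                               & d = DInt (opI o n1 n2)]]
  | EVar x => [set d | exists2 d', rho x = Some d' & leD d d']
  | ELam x e1 =>
      [set d | exists2 t : {fset D * D}, d = DTab t &
               forall d1 d1' : D, (d1, d1') \in t -> sem e1 (upd rho x d1) d1']
  | EApp e1 e2 =>
      [set d | exists (t : {fset D * D}) (d1 d1' d2 : D),
               [/\ sem e1 rho (DTab t), sem e2 rho d2, (d1, d1') \in t,
                   leD d1 d2 & leD d d1']]
  | EIf e1 e2 e3 =>
      [set d | exists n : int,
               [/\ sem e1 rho (DInt n), n <> 0%R -> sem e2 rho d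
                 & n = 0%R -> sem e3 rho d]]
  end.

Inductive step : expr -> expr -> Prop :=
| step_beta x e v : is_value v -> step (EApp (ELam x e) v) (subst x v e)
| step_op o n1 n2 : step (EOp o (EInt n1) (EInt n2)) (EInt (opI o n1 n2))
| step_if_true n e2 e3 : n <> 0%R -> step (EIf (EInt n) e2 e3) e2
| step_if_false e2 e3 : step (EIf (EInt 0) e2 e3) e3
| step_app_l e1 e1' e2 : step e1 e1' -> step (EApp e1 e2) (EApp e1' e2)
| step_op_l o e1 e1' e2 : step e1 e1' -> step (EOp o e1 e2) (EOp o e1' e2)
| step_if e1 e1' e2 e3 : step e1 e1' -> step (EIf e1 e2 e3) (EIf e1' e2 e3)
| step_app_r v e2 e2' :
    is_value v -> step e2 e2' -> step (EApp v e2) (EApp v e2')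
| step_op_r o v e2 e2' :
    is_value v -> step e2 e2' -> step (EOp o v e2) (EOp o v e2').

Definition terminates (e : expr) : Prop :=
  exists2 v, is_value v & clos_refl_trans expr step e v.

End Language.

(* Main.v *)
Require Import Defs.
From mathcomp Require Import all_boot ssrint classical_sets.
From mathcomp Require Import finmap.
From Stdlib Require Import Relation_Operators.

Set Implicit Arguments.
Unset Strict Implicit.
Unset Printing Implicit Defensive.

(** The semantics is compositional and adequate: a closed expression terminates
    if and only if its denotation is inhabited.  Termination gives inhabitation
    because reduction can only shrink denotations; in the beta case, the finitely
    many approximations of the argument used in the body are merged into one,
    denotations of values being directed.  Conversely, a logical relation
    between elements of [D] and syntactic values, defined by recursion on the
    former, shows that every element of a denotation is witnessed by a
    reduction to a value. *)

(** * The order on [D] *)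

Lemma leD_refl d : leD d d.
Proof. by elim/D_ind: d => [n|t _]; constructor. Qed.

Lemma leD_trans d1 d2 d3 : leD d1 d2 -> leD d2 d3 -> leD d1 d3.
Proof.
case=> [n|t t' tt'] h; first exact: h.
(* [DTab] is a function and not a constructor, so the index is generalized before inversion and
   [DTab_inj] identifies the two tables. *)
move E: (DTab t') h => u h; case: h E => [n|t1 t2 t12] E //.
by constructor; move/DTab_inj: E tt' => ->; move/fsubset_trans; apply.
Qed.

Section Adequacy.
Variables (Op : Type) (opI : Op -> int -> int -> int).

Implicit Types (e v w b : expr Op) (rho : env) (x y : var) (d : D).
Local Notation sem := (sem opI).
Local Notation reduces := (clos_refl_trans (expr Op) (step opI)).

(** * Monotonicity of denotations in the environment *)

(** Under a binder both environments receive the same entry, so the order stays covariant; variables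
    use transitivity of [leD]. Comparing free variables only makes independence from the other
    variables a special case. *)
Lemma sem_mono e rho rho' d :
  (forall y d1, y \in fv e -> rho y = Some d1 ->
     exists2 d2, rho' y = Some d2 & leD d1 d2) ->
  sem e rho d -> sem e rho' d.
Proof.
elim: e rho rho' d => [n|o e1 IH1 e2 IH2|x|x b IH|e1 IH1 e2 IH2|e1 IH1 e2 IH2 e3 IH3]
  rho rho' d le_rho /=; first by [].
- move=> [n1 [n2 [s1 s2 ->]]]; exists n1, n2; split=> //.
    by apply: IH1 s1 => y d1 yf; apply: le_rho; rewrite mem_cat yf.
  by apply: IH2 s2 => y d1 yf; apply: le_rho; rewrite mem_cat yf orbT.
- move=> [d1 rx dd1]; have [|d2 rx2 d12] := le_rho x d1 _ rx; first exact: mem_head.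
  by exists d2 => //; exact: leD_trans d12.
- move=> [t -> ht]; exists t => // d1 d1' /ht; apply: IH => y d2 yf.
  rewrite /upd; case: eqVneq => [_ [->]|yx]; first by exists d2 => //; exact: leD_refl.
  by apply: le_rho; rewrite mem_filter yx.
- move=> [t [d1 [d1' [d2 [s1 s2 td d12 dd]]]]]; exists t, d1, d1', d2; split=> //.
    by apply: IH1 s1 => y d3 yf; apply: le_rho; rewrite mem_cat yf.
  by apply: IH2 s2 => y d3 yf; apply: le_rho; rewrite mem_cat yf orbT.
- move=> [n [s1 s2 s3]]; exists n; split.
  + by apply: IH1 s1 => y d3 yf; apply: le_rho; rewrite !mem_cat yf.
  + by move=> /s2; apply: IH2 => y d3 yf; apply: le_rho; rewrite !mem_cat yf orbT.
  + by move=> /s3; apply: IH3 => y d3 yf; apply: le_rho; rewrite !mem_cat yf !orbT.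
Qed.

Lemma sem_eq_env e rho rho' d :
  (forall y, y \in fv e -> rho y = rho' y) -> sem e rho d -> sem e rho' d.
Proof.
move=> eq_rho; apply: sem_mono => y d1 /eq_rho -> ?.
by exists d1 => //; exact: leD_refl.
Qed.

Lemma sem_closed e rho rho' d : closed_expr e -> sem e rho d -> sem e rho' d.
Proof. by move=> /nilP cl_e; apply: sem_eq_env => y; rewrite cl_e. Qed.

Lemma sem_upd_mono e rho x d1 d2 d :
  leD d1 d2 -> sem e (upd rho x d1) d -> sem e (upd rho x d2) d.
Proof.
move=> d12; apply: sem_mono => y d3 _; rewrite /upd.
by case: eqP => [_ [<-]|_ ->]; [exists d2 | exists d3 => //; exact: leD_refl].
Qed.

(** * Denotations of values *)

Lemma value_closed v : is_value v -> closed_expr v.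
Proof. by case: v. Qed.

Lemma sem_value_inhabited v rho : is_value v -> exists d, sem v rho d.
Proof.
case: v => // [n _|x b _]; first by exists (DInt n).
by exists (DTab fset0), fset0 => // d d'; rewrite inE.
Qed.

(** Membership of a table in the denotation of an abstraction is checked entry by entry, hence is
    preserved by union. *)
Lemma sem_value_directed v rho d1 d2 : is_value v -> sem v rho d1 -> sem v rho d2 ->
  exists d, [/\ sem v rho d, leD d1 d & leD d2 d].
Proof.
case: v => // [n _ /= -> ->|x b _ /= [t1 -> h1] [t2 -> h2]].
  by exists (DInt n); split=> //; exact: leD_refl.
exists (DTab (t1 `|` t2)%fset); split.
- by exists (t1 `|` t2)%fset => // d d'; rewrite inE => /orP[/h1|/h2].
- by constructor; exact: fsubsetUl.
- by constructor; exact: fsubsetUr.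
Qed.

(** Directedness iterated along a finite list: enlarging the approximation keeps the earlier
    properties because [Q] is monotone. *)
Lemma sem_value_common (T : eqType) (Q : T -> D -> Prop) v rho (s : seq T) :
  is_value v ->
  (forall p d1 d2, leD d1 d2 -> Q p d1 -> Q p d2) ->
  (forall p, p \in s -> exists2 d, sem v rho d & Q p d) ->
  exists2 d, sem v rho d & forall p, p \in s -> Q p d.
Proof.
move=> val_v Qmono; elim: s => [|p s IH] Qs.
  by have [d sd] := sem_value_inhabited rho val_v; exists d.
have [|d1 sd1 Q1] := IH; first by move=> q qs; apply: Qs; rewrite inE qs orbT.
have [|d2 sd2 Q2] := Qs p; first by rewrite inE eqxx.
have [d [sd d1d d2d]] := sem_value_directed val_v sd1 sd2.
exists d => // q; rewrite inE => /predU1P[->|/Q1 Qq]; first exact: Qmono Q2.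
exact: Qmono Qq.
Qed.

(** * Substitution and reduction *)

(** Each subterm supplies its own approximation of [v]; these are joined by directedness and the
    join is absorbed by monotonicity. Where [x] does not occur or is shadowed, any element of the
    denotation of [v] will do. *)
Lemma sem_subst e x v rho d : is_value v -> sem (subst x v e) rho d ->
  exists2 dv, sem v rho dv & sem e (upd rho x dv) d.
Proof.
move=> val_v.
elim: e rho d => [n|o e1 IH1 e2 IH2|y|y b IH|e1 IH1 e2 IH2|e1 IH1 e2 IH2 e3 IH3]
  rho d /=.
- by move=> ->; have [dv] := sem_value_inhabited rho val_v; exists dv.
- move=> [n1 [n2 [/IH1[u1 v1 s1] /IH2[u2 v2 s2] ->]]].
  have [u [vu le1 le2]] := sem_value_directed val_v v1 v2.
  by exists u => //; exists n1, n2; split=> //; [exact: sem_upd_mono s1|exact: sem_upd_mono s2].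
- case: eqVneq => [->|yx] s.
    by exists d => //; exists d; [rewrite /upd eqxx | exact: leD_refl].
  have [dv ?] := sem_value_inhabited rho val_v; exists dv => //.
  by rewrite /upd (negbTE yx).
- case: eqVneq => [->|yx] [t -> ht].
    have [dv ?] := sem_value_inhabited rho val_v; exists dv => //.
    exists t => // d1 d1' /ht; apply: sem_eq_env => z _.
    by rewrite /upd; case: eqP.
  (* Each entry of [t] comes with its own approximation of [v]; finiteness of [t] allows a single
     one for all entries. *)
  have [||dv sdv h] := @sem_value_common _
    (fun p dv => sem b (upd (upd rho x dv) y p.1) p.2) v rho t val_v.
  + move=> p d1 d2 d12; apply: sem_mono => z d3 _; rewrite /upd.
    case: eqP => [_ ->|_]; first by exists d3 => //; exact: leD_refl.
    by case: eqP => [_ [<-]|_ ->]; [exists d2 | exists d3 => //; exact: leD_refl].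
  + move=> [d1 d1'] /ht /IH[dv sdv sb]; exists dv.
      (* The induction hypothesis speaks of the environment extended at [y], which the closed [v]
         ignores. *)
      exact: sem_closed (value_closed val_v) sdv.
    apply: sem_eq_env sb => z _; rewrite /upd /=.
    by case: eqVneq => // ->; rewrite eq_sym (negbTE yx).
  + by exists dv => //; exists t => // d1 d1' /h.
- move=> [t [d1 [d1' [d2 [/IH1[u1 v1 s1] /IH2[u2 v2 s2] td d12 dd]]]]].
  have [u [vu le1 le2]] := sem_value_directed val_v v1 v2.
  exists u => //; exists t, d1, d1', d2.
  by split=> //; [exact: sem_upd_mono s1|exact: sem_upd_mono s2].
- move=> [n [/IH1[u1 v1 s1] s2 s3]].
  (* Only the branch selected by [n] supplies an approximation; the other implication is vacuous. *)
  have [u2 v2 [s2' s3']] : exists2 u, sem v rho u &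
      (n <> 0%R -> sem e2 (upd rho x u) d) /\ (n = 0%R -> sem e3 (upd rho x u) d).
    by case: (eqVneq n 0%R) => [/[dup] n0 /s3 /IH3|/eqP/[dup] n0 /s2 /IH2] [u2 ? ?];
      exists u2.
  have [u [vu le1 le2]] := sem_value_directed val_v v1 v2.
  exists u => //; exists n; split; first exact: sem_upd_mono s1.
    by move=> /s2'; exact: sem_upd_mono.
  by move=> /s3'; exact: sem_upd_mono.
Qed.

Lemma sem_step e e' rho d : step opI e e' -> sem e' rho d -> sem e rho d.
Proof.
move=> st; elim: st rho d => {e e'} [x b v val_v|o n1 n2|n e2 e3 n0|e2 e3
  |e1 e1' e2 _ IH|o e1 e1' e2 _ IH|e1 e1' e2 e3 _ IH|v e2 e2' _ _ IH|o v e2 e2' _ _ IH] rho d /=.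
- move=> /(sem_subst val_v)[dv sdv sd].
  (* A one-entry table, sending the approximation [dv] to the result [d], suffices for the
     abstraction. *)
  exists [fset (dv, d)]%fset, dv, d, dv; split=> //; try exact: leD_refl.
    exists [fset (dv, d)]%fset => // d1 d1'; rewrite inE => /eqP.
    by case=> -> ->.
  by rewrite inE.
- by move=> ->; exists n1, n2.
- by move=> s; exists n.
- by move=> s; exists 0%R.
- move=> [t [d1 [d1' [d2 [s1 s2 td d12 dd]]]]]; exists t, d1, d1', d2.
  by split=> //; exact: IH.
- by move=> [n1 [n2 [s1 s2 ->]]]; exists n1, n2; split=> //; exact: IH.
- by move=> [n [s1 s2 s3]]; exists n; split=> //; exact: IH.
- move=> [t [d1 [d1' [d2 [s1 s2 td d12 dd]]]]]; exists t, d1, d1', d2.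
  by split=> //; exact: IH.
- by move=> [n1 [n2 [s1 s2 ->]]]; exists n1, n2; split=> //; exact: IH.
Qed.

Lemma sem_reduces e e' rho d : reduces e e' -> sem e' rho d -> sem e rho d.
Proof.
by elim=> [? ? /sem_step|//|? ? ? _ IH1 _ IH2 /IH2/IH1]; first exact.
Qed.

Lemma terminates_sem e rho : terminates opI e -> exists d, sem e rho d.
Proof.
case=> v /(sem_value_inhabited rho)[d sd] red.
by exists d; exact: sem_reduces sd.
Qed.

(** * Simultaneous substitution *)

Definition srem (s : var -> option (expr Op)) x : var -> option (expr Op) :=
  fun y => if y == x then None else s y.

(** Closes open terms for the induction in [sem_realizes]. Capture is not avoided here; [closing]
    excludes it. *)
Fixpoint psubst (s : var -> option (expr Op)) e : expr Op :=
  match e with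
  | EInt n => EInt Op n
  | EOp o e1 e2 => EOp o (psubst s e1) (psubst s e2)
  | EVar y => odflt (EVar Op y) (s y)
  | ELam y b => ELam y (psubst (srem s y) b)
  | EApp e1 e2 => EApp (psubst s e1) (psubst s e2)
  | EIf e1 e2 e3 => EIf (psubst s e1) (psubst s e2) (psubst s e3)
  end.

Definition closing (s : var -> option (expr Op)) : Prop :=
  forall y w, s y = Some w -> closed_expr w.

Lemma closing_rem s x : closing s -> closing (srem s x).
Proof. by move=> cl_s y w; rewrite /srem; case: eqP => // _ /cl_s. Qed.

Lemma psubst_id s e : (forall y, y \in fv e -> s y = None) -> psubst s e = e.
Proof.
elim: e s => [n|o e1 IH1 e2 IH2|x|x b IH|e1 IH1 e2 IH2|e1 IH1 e2 IH2 e3 IH3] s s0 //=.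
- by rewrite IH1 ?IH2 // => y yf; apply: s0; rewrite mem_cat yf ?orbT.
- by rewrite s0 // mem_head.
- rewrite IH // => y yf; rewrite /srem; case: eqVneq => // yx.
  by apply: s0; rewrite mem_filter yx.
- by rewrite IH1 ?IH2 // => y yf; apply: s0; rewrite mem_cat yf ?orbT.
- by rewrite IH1 ?IH2 ?IH3 // => y yf; apply: s0; rewrite !mem_cat yf ?orbT.
Qed.

Lemma eq_psubst s s' e : s =1 s' -> psubst s e = psubst s' e.
Proof.
elim: e s s' => [n|o e1 IH1 e2 IH2|x|x b IH|e1 IH1 e2 IH2|e1 IH1 e2 IH2 e3 IH3] s s' ss' //=.
- by rewrite (IH1 _ _ ss') (IH2 _ _ ss').
- by rewrite ss'.
- by congr ELam; apply: IH => y; rewrite /srem ss'.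
- by rewrite (IH1 _ _ ss') (IH2 _ _ ss').
- by rewrite (IH1 _ _ ss') (IH2 _ _ ss') (IH3 _ _ ss').
Qed.

Lemma mem_fv_psubst s e y : closing s ->
  y \in fv (psubst s e) -> y \in fv e /\ ~~ isSome (s y).
Proof.
elim: e s => [n|o e1 IH1 e2 IH2|x|x b IH|e1 IH1 e2 IH2|e1 IH1 e2 IH2 e3 IH3] s cl_s //=.
- by rewrite !mem_cat => /orP[/IH1|/IH2] [] // -> ->; rewrite ?orbT.
- case sx: (s x) => [w|] /=; first by move/nilP: (cl_s _ _ sx) => ->.
  by rewrite mem_seq1 => /eqP ->; rewrite sx; split=> //; exact: mem_head.
- rewrite !mem_filter => /andP[yx /IH[|-> ]]; first exact: closing_rem.
  by rewrite /srem (negbTE yx).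
- by rewrite !mem_cat => /orP[/IH1|/IH2] [] // -> ->; rewrite ?orbT.
- by rewrite !mem_cat => /or3P[/IH1|/IH2|/IH3] [] // -> ->; rewrite ?orbT.
Qed.

Lemma subst_notin x v e : x \notin fv e -> subst x v e = e.
Proof.
elim: e => [n|o e1 IH1 e2 IH2|y|y b IH|e1 IH1 e2 IH2|e1 IH1 e2 IH2 e3 IH3] //=.
- by rewrite mem_cat negb_or => /andP[/IH1 -> /IH2 ->].
- by rewrite inE eq_sym => /negbTE ->.
- rewrite mem_filter negb_and negbK eq_sym.
  by case: eqVneq => //= _ /IH ->.
- by rewrite mem_cat negb_or => /andP[/IH1 -> /IH2 ->].
- by rewrite !mem_cat !negb_or => /and3P[/IH1 -> /IH2 -> /IH3 ->].
Qed.

Definition supd (s : var -> option (expr Op)) x w : var -> option (expr Op) :=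
  fun y => if y == x then Some w else s y.

(** Turns the result of a beta step back into an instance of [psubst]: the expressions inserted by
    [s] are closed, so substituting for [x] leaves them intact. *)
Lemma subst_psubst s x w e : closing s ->
  subst x w (psubst (srem s x) e) = psubst (supd s x w) e.
Proof.
elim: e s => [n|o e1 IH1 e2 IH2|y|y b IH|e1 IH1 e2 IH2|e1 IH1 e2 IH2 e3 IH3] s cl_s //=.
- by rewrite IH1 ?IH2.
- rewrite /srem /supd; case: eqVneq => [->|yx] /=; first by rewrite eqxx.
  case sy: (s y) => [u|] /=; last by rewrite (negbTE yx).
  by rewrite subst_notin //; move/nilP: (cl_s _ _ sy) => ->.
- congr ELam; case: eqVneq => [->|yx].
    by apply: eq_psubst => z; rewrite /srem /supd; case: eqP.
  transitivity (subst x w (psubst (srem (srem s y) x) b)).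
    by congr subst; apply: eq_psubst => z; rewrite /srem; do 2!case: eqP.
  rewrite IH; last exact: closing_rem.
  apply: eq_psubst => z; rewrite /srem /supd.
  by case: (eqVneq z x) => // ->; rewrite eq_sym (negbTE yx).
- by rewrite IH1 ?IH2.
- by rewrite IH1 ?IH2 ?IH3.
Qed.

(** * The logical relation and adequacy *)

(* Defined on the underlying trees because only these support a recursion into
   [Prop]; [D_ind] eliminates into proofs only. *)
Fixpoint realizes_tree (a : tree) (v : expr Op) : Prop :=
  match a with
  | TInt n => v = EInt Op n
  | TTab s => exists x b, [/\ v = ELam x b, is_value v &
      foldr (fun p P => (forall w, realizes_tree p.1 w ->
          exists2 v', reduces (subst x w b) v' & realizes_tree p.2 v') /\ P)
        True s]
  end.

Definition realizes d v : Prop := realizes_tree (Dval d) v.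

(** Recovers the usual function clause of a logical relation from the [foldr] conjunction, a form
    that admits structural recursion on trees. *)
Lemma realizes_tab (t : {fset D * D}) v : realizes (DTab t) v <->
  exists x b, [/\ v = ELam x b, is_value v &
    forall d d', (d, d') \in t -> forall w, realizes d w ->
      exists2 v', reduces (subst x w b) v' & realizes d' v'].
Proof.
have foldrP (T : eqType) (Q : T -> Prop) s :
    foldr (fun p P => Q p /\ P) True s <-> forall p, p \in s -> Q p.
  elim: s => [|p s IH] /=; first by [].
  split=> [[Qp /IH Qs] q|Qs]; first by rewrite inE => /predU1P[->|/Qs].
  by split; [apply: Qs; rewrite inE eqxx | apply/IH => q qs; apply: Qs; rewrite inE qs orbT].
split=> -[x [b [-> vl h]]]; exists x, b; split=> //.
  move=> d d' ddt; move/(foldrP _ (fun p => _)): h => /(_ (pair_val (d, d'))); apply.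
  exact: in_imfset.
apply/(foldrP _ (fun p => _)) => p /imfsetP[[d d'] /= ddt ->]; exact: h.
Qed.

Lemma realizes_value d v : realizes d v -> is_value v.
Proof. by elim/D_ind: d => [n ->|t _ /realizes_tab[x [b []]]]. Qed.

Lemma realizes_le d d' v : leD d d' -> realizes d' v -> realizes d v.
Proof.
case=> [//|t t' /fsubsetP tt'] /realizes_tab[x [b [-> vl h]]].
by apply/realizes_tab; exists x, b; split=> // d1 d1' /tt' /h.
Qed.

Lemma reduces_congr (f : expr Op -> expr Op) e e' :
  (forall e1 e2, step opI e1 e2 -> step opI (f e1) (f e2)) ->
  reduces e e' -> reduces (f e) (f e').
Proof.
move=> fS; elim=> [e1 e2 /fS|e1|e1 e2 e3 _ h12 _ h23].
- exact: rt_step.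
- exact: rt_refl.
- exact: rt_trans h23.
Qed.

(** Fundamental lemma of the logical relation. [s] must cover all free variables of [e], even those
    where [rho] is undefined, so that substituted abstractions are closed and thus values. *)
Lemma sem_realizes e s rho d : closing s ->
  (forall y, y \in fv e -> isSome (s y)) ->
  (forall y d1, rho y = Some d1 -> exists2 w, s y = Some w & realizes d1 w) ->
  sem e rho d -> exists2 v, reduces (psubst s e) v & realizes d v.
Proof.
elim: e s rho d => [n|o e1 IH1 e2 IH2|x|x b IH|e1 IH1 e2 IH2|e1 IH1 e2 IH2 e3 IH3]
  s rho d cl_s dom_s real_s /=.
- by move=> ->; exists (EInt Op n) => //; exact: rt_refl.
- move=> [n1 [n2 [s1 s2 ->]]].
  have [|v1 r1 e1n] := IH1 s rho _ cl_s _ real_s s1.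
    by move=> y yf; apply: dom_s; rewrite mem_cat yf.
  have [|v2 r2 e2n] := IH2 s rho _ cl_s _ real_s s2.
    by move=> y yf; apply: dom_s; rewrite mem_cat yf orbT.
  rewrite /realizes /= in e1n e2n; subst v1 v2.
  exists (EInt Op (opI o n1 n2)) => //.
  apply: rt_trans.
    by apply: (reduces_congr (f := fun e => EOp o e _)) r1 => *; constructor.
  apply: rt_trans.
    by apply: (reduces_congr (f := fun e => EOp o _ e)) r2 => *; constructor.
  by apply: rt_step; constructor.
- move=> [d1 /real_s[w -> rw] dd1]; exists w; first exact: rt_refl.
  exact: realizes_le rw.
- move=> [t -> ht]; exists (ELam x (psubst (srem s x) b)); first exact: rt_refl.
  apply/realizes_tab; exists x, (psubst (srem s x) b); split=> //=.
    rewrite /closed_expr; apply/nilP.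
    case E: fv => [//|y l].
    have: y \in fv (psubst s (ELam x b)) by rewrite [fv _]E mem_head.
    by case/(mem_fv_psubst cl_s) => /dom_s ->.
  (* The body runs under [s] extended by the argument [w], in step with the environment extended by
     [d1]. *)
  move=> d1 d1' /ht sb w rw; rewrite subst_psubst //; apply: IH sb.
  + move=> y u; rewrite /supd; case: eqP => [_ [<-]|_]; last exact: cl_s.
    exact/value_closed/realizes_value/rw.
  + move=> y yf; rewrite /supd; case: eqVneq => // yx.
    by apply: dom_s; rewrite mem_filter yx.
  + move=> y d2; rewrite /upd /supd; case: eqP => [_ [<-]|_]; last exact: real_s.
    by exists w.
- move=> [t [d1 [d1' [d2 [s1 s2 td d12 dd]]]]].
  have [|v1 r1 /realizes_tab[x [b [v1E val1 h]]]] := IH1 s rho _ cl_s _ real_s s1.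
    by move=> y yf; apply: dom_s; rewrite mem_cat yf.
  have [|v2 r2 /[dup] /realizes_value val2 rv2] := IH2 s rho _ cl_s _ real_s s2.
    by move=> y yf; apply: dom_s; rewrite mem_cat yf orbT.
  (* [v2] realizes [d2], hence the smaller [d1] required by the table entry; the result realizes
     [d1'], hence the smaller [d]. *)
  have [v rv /(realizes_le dd) real_v] := h _ _ td _ (realizes_le d12 rv2).
  exists v => //; apply: rt_trans.
    by apply: (reduces_congr (f := fun e => EApp e _)) r1 => *; constructor.
  apply: rt_trans.
    by apply: (reduces_congr (f := fun e => EApp _ e)) r2 => *; constructor.
  by apply: rt_trans rv; rewrite v1E; apply: rt_step; constructor.
- move=> [n [s1 s2 s3]].
  have [|v1 r1 e1n] := IH1 s rho _ cl_s _ real_s s1.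
    by move=> y yf; apply: dom_s; rewrite !mem_cat yf.
  rewrite /realizes /= in e1n; subst v1.
  have rif := reduces_congr (f := fun e => EIf e (psubst s e2) (psubst s e3))
    (fun e e' => @step_if _ opI e e' _ _) r1.
  case: (eqVneq n 0%R) => [/[dup] n0 /s3 se|/eqP/[dup] n0 /s2 se].
    have [|v rv real_v] := IH3 s rho _ cl_s _ real_s se.
      by move=> y yf; apply: dom_s; rewrite !mem_cat yf !orbT.
    exists v => //; apply: (rt_trans _ _ _ _ _ rif); apply: rt_trans rv.
    by rewrite n0; apply: rt_step; constructor.
  have [|v rv real_v] := IH2 s rho _ cl_s _ real_s se.
    by move=> y yf; apply: dom_s; rewrite !mem_cat yf orbT.
  exists v => //; apply: (rt_trans _ _ _ _ _ rif); apply: rt_trans rv.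
  by apply: rt_step; constructor.
Qed.

Lemma sem_terminates e d : closed_expr e -> sem e (fun=> None) d -> terminates opI e.
Proof.
move=> /nilP cl_e /(sem_realizes (s := fun=> None))[//|y|//|v].
  by rewrite cl_e.
by rewrite psubst_id // => red_ev /realizes_value; exists v.
Qed.

(** * Compositionality and contextual equivalence *)

(** Every clause of [sem] is monotone in the denotations of subterms. The inclusion is assumed at
    all environments because [C] may bind free variables of [e]. *)
Lemma sem_plug C e e' : (forall rho d, sem e rho d -> sem e' rho d) ->
  forall rho d, sem (plug C e) rho d -> sem (plug C e') rho d.
Proof.
move=> ee'; elim: C => [|o C IH e2|o e1 C IH|x C IH|C IH e2|e1 C IH] rho d /=.
- exact: ee'.
- by move=> [n1 [n2 [s1 s2 ->]]]; exists n1, n2; split=> //; exact: IH.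
- by move=> [n1 [n2 [s1 s2 ->]]]; exists n1, n2; split=> //; exact: IH.
- by move=> [t -> ht]; exists t => // d1 d1' /ht /IH.
- move=> [t [d1 [d1' [d2 [s1 s2 td d12 dd]]]]]; exists t, d1, d1', d2.
  by split=> //; exact: IH.
- move=> [t [d1 [d1' [d2 [s1 s2 td d12 dd]]]]]; exists t, d1, d1', d2.
  by split=> //; exact: IH.
Qed.

Lemma terminates_plug C e e' : (forall rho d, sem e rho d -> sem e' rho d) ->
  closed_expr (plug C e') ->
  terminates opI (plug C e) -> terminates opI (plug C e').
Proof.
move=> ee' cl_e' /(terminates_sem (fun=> None))[d /(sem_plug ee')].
exact: sem_terminates.
Qed.

End Adequacy.

Theorem theorem4 (Op : Type) (opI : Op -> int -> int -> int) (e e' : expr Op)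
    (sem_ee' : forall rho : env, sem opI e rho = sem opI e' rho)
    (C : ctx Op) (closed_Ce : closed_expr (plug C e))
    (closed_Ce' : closed_expr (plug C e')) :
  terminates opI (plug C e) <-> terminates opI (plug C e').
Proof.
by split; apply: terminates_plug => // rho d; rewrite sem_ee'.
Qed.
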